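(* Let $L\in(0,\infty)$ and $\rho\in\mathbb{R}$ with $\rho>-\frac{1}{2L}$. Let $F:\mathbb{R}^d\to\mathbb{R}^d$ be a saddle-gradient operator that is $L$-Lipschitz continuous and $\rho$-comonotone. Let $z_0\in\mathbb{R}^d$ and let $\{z_k\}_{k\ge 0}$ be the sequence generated by the FEG method, i.e., for $k=0,1,2,\dots$ $$z_{k+1/2} = z_k + \tfrac{1}{k+1}(z_0-z_k) - \Big(1-\tfrac{1}{k+1}\Big)\Big(\tfrac{1}{L}+2\rho\Big)Fz_k,$$ $$z_{k+1} = z_k + \tfrac{1}{k+1}(z_0-z_k) - \tfrac{1}{L}Fz_{k+1/2} - \Big(1-\tfrac{1}{k+1}\Big)2\rho\, Fz_k .$$ Then for any $z_*\in\mathbb{R}^d$ with $Fz_*=0$ and for all $k\ge 1$, $$\|Fz_k\|^2\le \frac{4\|z_0-z_*\|^2}{\left(\frac{1}{L}+2\rho\right)^2k^2}.$$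
   Context: Write $d=d_x+d_y$ and $z=(x,y)\in\mathbb{R}^{d_x}\times\mathbb{R}^{d_y}=\mathbb{R}^d$, with the Euclidean inner product and norm. For a continuously differentiable (possibly nonconvex-nonconcave) $f:\mathbb{R}^{d_x}\times\mathbb{R}^{d_y}\to\mathbb{R}$, its saddle-gradient operator is $F=(\nabla_x f,-\nabla_y f)$; $Fz$ denotes $F(z)$. $F$ is $L$-Lipschitz continuous if $\|Fz-Fz'\|\le L\|z-z'\|$ for all $z,z'\in\mathbb{R}^d$. $F$ is $\rho$-comonotone if $\langle Fz-Fz',z-z'\rangle\ge\rho\|Fz-Fz'\|^2$ for all $z,z'\in\mathbb{R}^d$ ($\rho$ may be negative, zero or positive). *)

(* Defs.v *)
From HB Require Import structures.
From mathcomp Require Import all_boot all_order all_algebra.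
From mathcomp Require Import all_classical all_reals all_analysis.

Set Implicit Arguments.
Unset Strict Implicit.
Unset Printing Implicit Defensive.

Import Order.TTheory GRing.Theory Num.Theory.
Import numFieldNormedType.Exports.

Local Open Scope ring_scope.

(* The library's norm `|u| on row vectors is the sup norm, hence the explicit
   Euclidean structure. The topology is the same, so continuity and
   differentiability below are the usual ones. *)
Definition edot (R : realType) (n : nat) (u v : 'rV[R]_n) : R :=
  \sum_(i < n) u 0 i * v 0 i.

Definition enorm (R : realType) (n : nat) (u : 'rV[R]_n) : R :=
  Num.sqrt (edot u u).

Definition gradient (R : realType) (n : nat) (g : 'rV[R]_n -> R)
    (u : 'rV[R]_n) : 'rV[R]_n :=
  \row_(i < n) 'D_(delta_mx 0 i) g u.

Definition grad_x (R : realType) (dx dy : nat)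
    (f : 'rV[R]_dx * 'rV[R]_dy -> R) (z : 'rV[R]_dx * 'rV[R]_dy) : 'rV[R]_dx :=
  gradient (fun x => f (x, z.2)) z.1.

Definition grad_y (R : realType) (dx dy : nat)
    (f : 'rV[R]_dx * 'rV[R]_dy -> R) (z : 'rV[R]_dx * 'rV[R]_dy) : 'rV[R]_dy :=
  gradient (fun y => f (z.1, y)) z.2.

Definition continuously_differentiable (R : realType) (dx dy : nat)
    (f : 'rV[R]_dx * 'rV[R]_dy -> R) : Prop :=
  [/\ forall z, differentiable f z,
      continuous (grad_x f) & continuous (grad_y f)].

(* A point (x, y) of R^dx * R^dy is identified with row_mx x y in R^(dx+dy). *)
Definition saddle_gradient (R : realType) (dx dy : nat)
    (f : 'rV[R]_dx * 'rV[R]_dy -> R) (z : 'rV[R]_(dx + dy)) :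
    'rV[R]_(dx + dy) :=
  let xy := (lsubmx z, rsubmx z) in row_mx (grad_x f xy) (- grad_y f xy).

Definition is_saddle_gradient (R : realType) (dx dy : nat)
    (F : 'rV[R]_(dx + dy) -> 'rV[R]_(dx + dy)) : Prop :=
  exists f : 'rV[R]_dx * 'rV[R]_dy -> R,
    continuously_differentiable f /\ forall z, F z = saddle_gradient f z.

Definition lipschitz_operator (R : realType) (n : nat) (L : R)
    (F : 'rV[R]_n -> 'rV[R]_n) : Prop :=
  forall z z', enorm (F z - F z') <= L * enorm (z - z').

Definition comonotone (R : realType) (n : nat) (rho : R)
    (F : 'rV[R]_n -> 'rV[R]_n) : Prop :=
  forall z z', edot (F z - F z') (z - z') >= rho * enorm (F z - F z') ^+ 2.

(* zh k stands for the half-step iterate z_{k+1/2}. *)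
Definition FEG_sequence (R : realType) (n : nat) (L rho : R)
    (F : 'rV[R]_n -> 'rV[R]_n) (z0 : 'rV[R]_n) (z zh : nat -> 'rV[R]_n) : Prop :=
  z 0%N = z0 /\
  forall k : nat,
    let b : R := 1 / (k%:R + 1) in
    zh k = z k + b *: (z0 - z k)
           - ((1 - b) * (1 / L + 2 * rho)) *: F (z k) /\
    z k.+1 = z k + b *: (z0 - z k) - (1 / L) *: F (zh k)
             - ((1 - b) * (2 * rho)) *: F (z k).

(* Main.v *)
Require Import Defs.
From HB Require Import structures.
From mathcomp Require Import all_boot all_order all_algebra.
From mathcomp Require Import all_classical all_reals all_analysis.
From mathcomp Require Import ring lra.

Set Implicit Arguments.
Unset Strict Implicit.
Unset Printing Implicit Defensive.

Import Order.TTheory GRing.Theory Num.Theory.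
Import numFieldNormedType.Exports.

Local Open Scope ring_scope.

(* Write g_k = F z_k and s = 1/L + 2 rho.  The potential
     V_k = (s k^2 / 2 - rho k) |g_k|^2 - k <g_k, z_0 - z_k>
   is nonincreasing: k (k+1) times the comonotonicity inequality between
   z_{k+1} and z_k, plus (k+1)^2 / (2 L) times the (squared) Lipschitz
   inequality between z_{k+1} and z_{k+1/2}, is exactly V_{k+1} <= V_k.  As
   V_0 = 0, comonotonicity between z_k and z_* turns V_k <= 0 into
   (s k / 2) |g_k|^2 <= <g_k, z_0 - z_*>, and the rate follows. *)

Section EuclideanInnerProduct.
Variables (R : realType) (n : nat).
Implicit Types (u v w : 'rV[R]_n) (a : R).

Lemma edotC u v : edot u v = edot v u.
Proof. by apply: eq_bigr => i _; rewrite mulrC. Qed.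

Lemma edotDl u v w : edot (u + v) w = edot u w + edot v w.
Proof. by rewrite -big_split; apply: eq_bigr => i _; rewrite mxE mulrDl. Qed.

Lemma edotZl a u v : edot (a *: u) v = a * edot u v.
Proof. by rewrite /edot mulr_sumr; apply: eq_bigr => i _; rewrite mxE mulrA. Qed.

Lemma edotNl u v : edot (- u) v = - edot u v.
Proof. by rewrite -scaleN1r edotZl mulN1r. Qed.

Lemma edotDr u v w : edot w (u + v) = edot w u + edot w v.
Proof. by rewrite !(edotC w) edotDl. Qed.

Lemma edotZr a u v : edot v (a *: u) = a * edot v u.
Proof. by rewrite !(edotC v) edotZl. Qed.

Lemma edotNr u v : edot v (- u) = - edot v u.
Proof. by rewrite !(edotC v) edotNl. Qed.

Definition edotE := (edotDl, edotDr, edotNl, edotNr, edotZl, edotZr).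

Lemma edot_ge0 u : 0 <= edot u u.
Proof. by apply: sumr_ge0 => i _; rewrite -expr2 sqr_ge0. Qed.

Lemma enorm_ge0 u : 0 <= enorm u.
Proof. exact: sqrtr_ge0. Qed.

Lemma sqr_enorm u : enorm u ^+ 2 = edot u u.
Proof. exact/sqr_sqrtr/edot_ge0. Qed.

(** Expanding [0 <= |v - a u|^2] gives [|v|^2 >= 2 a <u, v> - a^2 |u|^2], and the hypothesis times
    [2 a] bounds the right side below by [a^2 |u|^2]. No Cauchy-Schwarz and no division by [|u|]. *)
Lemma edot_bound a u v : 0 <= a ->
  a * edot u u <= edot u v -> a ^+ 2 * edot u u <= edot v v.
Proof.
move=> a_ge0 auv; have := edot_ge0 (v - a *: u).
have := ler_wpM2l a_ge0 auv.
rewrite !edotE (edotC v u); lra.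
Qed.

End EuclideanInnerProduct.

Section FEG.
Variables (R : realType) (n : nat) (L rho : R) (F : 'rV[R]_n -> 'rV[R]_n).
Hypotheses (L_gt0 : 0 < L) (F_lip : lipschitz_operator L F).
Hypothesis F_comon : comonotone rho F.

Lemma lipschitz_edot u v :
  edot (F u - F v) (F u - F v) <= L ^+ 2 * edot (u - v) (u - v).
Proof.
rewrite -!sqr_enorm -exprMn lerXn2r ?nnegrE ?enorm_ge0 //.
by rewrite mulr_ge0 ?enorm_ge0 ?ltW.
Qed.

Definition FEG_potential (z0 : 'rV[R]_n) (z : nat -> 'rV[R]_n) (k : nat) : R :=
  ((1 / L + 2 * rho) * k%:R ^+ 2 / 2 - rho * k%:R) * edot (F (z k)) (F (z k))
  - k%:R * edot (F (z k)) (z0 - z k).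

Variables (z0 : 'rV[R]_n) (z zh : nat -> 'rV[R]_n).
Hypothesis z_FEG : FEG_sequence L rho F z0 z zh.

Lemma FEG_potential_decr k :
  FEG_potential z0 z k.+1 <= FEG_potential z0 z k.
Proof.
have /= [zhk zk1] := z_FEG.2 k; rewrite /FEG_potential.
have k1_gt0 : 0 < k%:R + 1 :> R by rewrite ltr_wpDl.
set u := F (z k); set h := F (zh k); set w := F (z k.+1).
set b := 1 / (k%:R + 1) in zhk zk1; set p := z0 - z k in zhk zk1 *.
have d1 : z k.+1 - z k = b *: p - (1 / L) *: h - ((1 - b) * (2 * rho)) *: u.
  by rewrite zk1 -/u -/h addrC !addrA addNr add0r.
(* The anchor terms and the [2 * rho] terms cancel. The factor [1 / L] then offsets the Lipschitz
   constant, and [|h|^2] will drop out of that inequality. *)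
have d2 : z k.+1 - zh k = (1 / L) *: ((1 - b) *: u - h).
  rewrite zk1 -/u -/h zhk -/u; apply/rowP => i; rewrite !mxE; ring.
have d3 : z0 - z k.+1 = p - (z k.+1 - z k) by rewrite /p opprB addrA addrNK.
clearbody p.
have := lipschitz_edot (z k.+1) (zh k); rewrite d2 -/h -/w.
have := F_comon (z k.+1) (z k); rewrite sqr_enorm d1 -/u -/w.
rewrite d3 d1 !edotE (edotC u w) (edotC h w) (edotC h u) -[k.+1%:R]natr1.
(* In terms of [N], [b = 1 / N] and [k = N - 1], so only [L] and [N] occur as denominators. *)
set N := k%:R + 1 in k1_gt0 b zhk zk1 d1 d2 *.
have -> : k%:R = N - 1 by rewrite /N addrK.
have k_ge0 : 0 <= N - 1 by rewrite /N addrK.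
have L0 : L != 0 by rewrite gt_eqF.
have N0 : N != 0 by rewrite gt_eqF.
move: (edot u u) (edot w w) (edot h h) (edot w u) (edot w h) (edot u h)
  (edot w p) (edot u p) => uu ww hh wu wh uh wp up.
move=> comon lip; rewrite -subr_ge0 in comon; rewrite -subr_ge0 in lip.
(* With weights [(N - 1) * N] and [N ^+ 2 / (2 * L)] the [<u, h>] terms cancel, and the [<w, h>]
   terms leave [N / L], exactly what [z0 - z k.+1] contributes to the potential difference. *)
have c_ge0 : 0 <= N ^+ 2 / (2 * L).
  by rewrite divr_ge0 ?sqr_ge0 // mulr_ge0 ?ltW.
have := addr_ge0 (mulr_ge0 (mulr_ge0 k_ge0 (ltW k1_gt0)) comon)
  (mulr_ge0 c_ge0 lip).
rewrite -[in X in _ -> X]subr_ge0; congr (0 <= _); rewrite /b; field.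
by rewrite L0 N0.
Qed.

Lemma FEG_potential_le0 k : FEG_potential z0 z k <= 0.
Proof.
elim: k => [|k]; last exact/le_trans/FEG_potential_decr.
by rewrite /FEG_potential expr0n /= !(mulr0, mul0r) !subr0 mul0r.
Qed.

(** Split [z0 - zs] at [z k]: since [F zs = 0], comonotonicity bounds the part [<F (z k), z k - zs>]
    below by [rho |F (z k)|^2], which absorbs the term [- rho * k%:R] of the potential. *)
Lemma FEG_edot_bound zs k : F zs = 0 -> (0 < k)%N ->
  (1 / L + 2 * rho) * k%:R / 2 * edot (F (z k)) (F (z k))
    <= edot (F (z k)) (z0 - zs).
Proof.
move=> Fzs k_gt0; have k0 : 0 < k%:R :> R by rewrite ltr0n.
have := F_comon (z k) zs; rewrite Fzs subr0 sqr_enorm => comon.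
have := FEG_potential_le0 k; rewrite /FEG_potential => V_le0.
rewrite -(ler_pM2l k0).
have := ler_wpM2l (ltW k0) comon.
move: V_le0; rewrite !edotE; lra.
Qed.

End FEG.

Theorem theorem4p1 (R : realType) (dx dy : nat) (L rho : R)
    (L_gt0 : 0 < L) (rho_gt : - (1 / (2 * L)) < rho)
    (F : 'rV[R]_(dx + dy) -> 'rV[R]_(dx + dy))
    (F_saddle : is_saddle_gradient F)
    (F_lip : lipschitz_operator L F)
    (F_comon : comonotone rho F)
    (z0 : 'rV[R]_(dx + dy)) (z zh : nat -> 'rV[R]_(dx + dy))
    (z_FEG : FEG_sequence L rho F z0 z zh) :
  forall zs : 'rV[R]_(dx + dy), F zs = 0 ->
  forall k : nat, (1 <= k)%N ->
    enorm (F (z k)) ^+ 2 <=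
      4 * enorm (z0 - zs) ^+ 2 / ((1 / L + 2 * rho) ^+ 2 * k%:R ^+ 2).
Proof.
move=> zs Fzs k k_gt0; rewrite !sqr_enorm.
have k0 : 0 < k%:R :> R by rewrite ltr0n.
(* This is twice the lower bound on [rho]. *)
have s_gt0 : 0 < 1 / L + 2 * rho.
  have -> : 1 / L = 2 * (1 / (2 * L)) by field; rewrite gt_eqF.
  lra.
have c_ge0 : 0 <= (1 / L + 2 * rho) * k%:R / 2.
  by rewrite divr_ge0 // mulr_ge0 // ltW.
(* Squaring the coefficient [(1 / L + 2 * rho) * k%:R / 2] produces the constant 4. *)
have := edot_bound c_ge0 (FEG_edot_bound L_gt0 F_lip F_comon z_FEG Fzs k_gt0).
rewrite ler_pdivlMr ?mulr_gt0 ?exprn_gt0 //; lra.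
Qed.
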